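(* Let $G$ be a finite group and let $\mathcal{P}_G$ be the power graph associated to $G$. Then the exchange property (for resolving sets) holds in $\mathcal{P}_G$ if one of the following conditions is satisfied: (i) $G$ is cyclic and $|G|=2k+1$ for some positive integer $k$; (ii) $|G|$ is a power of a prime number $p$, and $G$ is abelian.
   Context: The (undirected) power graph $\mathcal{P}_G$ of a finite group $G$ is the simple graph whose vertices are the elements of $G$, with an edge between two distinct vertices $x$ and $y$ if $x^m=y$ or $y^m=x$ for some positive integer $m$; it is always connected. For a finite, simple, connected graph $\Gamma$ with vertex set $V(\Gamma)$, $d_\Gamma$ denotes the shortest-path distance. A set $W=\{w_1,\dots,w_k\}\subseteq V(\Gamma)$ is a resolving set if distinct vertices $v$ of $\Gamma$ have distinct representations $(d_\Gamma(v,w_1),\dots,d_\Gamma(v,w_k))$. A resolving set is minimal if it contains no resolving set as a proper subset. The exchange property (for resolving sets) holds in $\Gamma$ if, whenever $W_1$ and $W_2$ are minimal resolving sets of $\Gamma$, for every $u\in W_1$ there is a vertex $v\in W_2$ such that $(W_1\setminus\{u\})\cup\{v\}$ is also a minimal resolving set. *)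

(* Defs.v *)
From mathcomp Require Import all_boot all_fingroup all_solvable.

Set Implicit Arguments.
Unset Strict Implicit.
Unset Printing Implicit Defensive.

(* A finite simple graph is a symmetric irreflexive relation on a finType. *)
Section Graph.
Variables (T : finType) (e : rel T).

Definition walk (n : nat) (x y : T) : bool :=
  [exists p : n.-tuple T, path e x p && (last x p == y)].

(* If x and y are connected, the least such n is at most #|T|.-1;
   otherwise the value is #|T|. See gdist_path and gdist_min below. *)
Definition gdist (x y : T) : nat :=
  find (fun n => walk n x y) (iota 0 #|T|).

Definition representation (W : {set T}) (v : T) : seq nat :=
  [seq gdist v w | w <- enum W].

Definition resolving (W : {set T}) : bool := injectiveb (representation W).

Definition minimal_resolving (W : {set T}) : bool := minset resolving W.

Definition exchange_property : Prop :=
  forall W1 W2 : {set T}, minimal_resolving W1 -> minimal_resolving W2 ->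
  forall u : T, u \in W1 ->
  exists2 v : T, v \in W2 & minimal_resolving ((W1 :\ u) :|: [set v]).

Lemma walkP n x y :
  reflect (exists p, [/\ path e x p, last x p = y & size p = n]) (walk n x y).
Proof.
apply: (iffP existsP) => [[p /andP[ep /eqP lp]]|[p [ep lp /eqP sp]]].
  by exists p; rewrite size_tuple.
by exists (Tuple sp); rewrite /= ep lp eqxx.
Qed.

Lemma gdist_min x p : path e x p -> gdist x (last x p) <= size p.
Proof.
move=> ep; rewrite leqNgt; apply/negP => lt.
have szT : size p < #|T|.
  by apply: leq_trans lt _; rewrite -[leqRHS](size_iota 0) find_size.
have := before_find 0 lt; rewrite nth_iota // add0n => /walkP; apply.
by exists p.
Qed.

Lemma gdist_path x y : connect e x y ->
  exists p, [/\ path e x p, last x p = y & size p = gdist x y].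
Proof.
case/connectP=> q eq ->; case/shortenP: eq => p ep up _.
have szT : size p < #|T|.
  by rewrite -[(size p).+1]/(size (x :: p)) -(card_uniqP up) max_card.
have lt : gdist x (last x p) < #|T| := leq_ltn_trans (gdist_min ep) szT.
have /(nth_find 0) : has (fun n => walk n x (last x p)) (iota 0 #|T|).
  by rewrite has_find size_iota.
by rewrite nth_iota // add0n => /walkP.
Qed.

End Graph.

Section PowerGraph.
Variable gT : finGroupType.
Local Open Scope group_scope.

(* Exponents 1, ..., #[x] already give every positive power of x; see
   power_graphP for the unbounded form. *)
Definition is_power (x y : gT) : bool := [exists m : 'I_#[x], x ^+ m.+1 == y].

Definition power_graph : rel gT :=
  fun x y => (x != y) && (is_power x y || is_power y x).

Lemma is_powerP x y :
  reflect (exists m : nat, (0 < m)%N /\ x ^+ m = y) (is_power x y).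
Proof.
apply: (iffP existsP) => [[m /eqP<-]|[m [m_gt0 <-]]]; first by exists m.+1.
case: m m_gt0 => // m _.
exists (Ordinal (ltn_pmod m (order_gt0 x))) => /=.
by rewrite !expgS expg_mod_order.
Qed.

Lemma power_graphP x y :
  reflect (x <> y /\ exists m : nat, (0 < m)%N /\ (x ^+ m = y \/ y ^+ m = x))
          (power_graph x y).
Proof.
apply: (iffP andP) => [[/eqP xy /orP[]/is_powerP[m [m0 xm]]]|].
- by split=> //; exists m; split=> //; left.
- by split=> //; exists m; split=> //; right.
case=> /eqP xy [m [m0 [] xm]]; split=> //; apply/orP; [left|right];
  by apply/is_powerP; exists m.
Qed.

Lemma power_graph_sym : symmetric power_graph.
Proof. by move=> x y; rewrite /power_graph eq_sym orbC. Qed.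

Lemma power_graph_irr : irreflexive power_graph.
Proof. by move=> x; rewrite /power_graph eqxx. Qed.

Lemma power_graph_connected x y : connect power_graph x y.
Proof.
have x1 z : connect power_graph z 1.
  case: (eqVneq z 1) => [->|z1]; first exact: connect0.
  apply/connect1/power_graphP; split; first exact/eqP.
  by exists #[z]; split=> //; left; rewrite expg_order.
apply: connect_trans (x1 x) _.
by rewrite (sym_connect_sym power_graph_sym).
Qed.

End PowerGraph.

Arguments power_graph gT : clear implicits.

(* Main.v *)
Require Import Defs.
From mathcomp Require Import all_boot all_fingroup all_solvable.

Set Implicit Arguments.
Unset Strict Implicit.
Unset Printing Implicit Defensive.

(** Call two vertices twins when every third vertex is equally far from both.
    A resolving set contains at least one of any two distinct twins, and the
    transposition of two twins is an isometry, so it maps minimal resolving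
    sets to minimal resolving sets. Suppose conversely that every set meeting
    all pairs of distinct twins is resolving. Then exchange holds: if u lies in
    W1 but not in W2, minimality of W1 gives a twin w of u outside W1, w must
    lie in W2, and (W1 \ u) + w is the image of W1 under the transposition of u
    and w ([exchange_of_separation]).

    The converse holds as soon as any two distinct vertices x, y that are not
    twins are separated by a third vertex z that has a twin z': one of z, z' is
    in the set, and both are equally far from x, and from y.

    In a power graph all distances are at most 2, and generators of the same
    cyclic subgroup are twins; so every element of order greater than 2 has a
    twin, its inverse. The identity is adjacent to everything and separates
    nothing. Only involutions remain. In odd order there are none. In an abelian
    2-group, let t be an involution adjacent to x but not to y. If x <> 1, the
    inverse of x separates x from y as well; if x = 1 and t = s ^ 2, so does s.
    If x = 1 and t is not a square, then t itself has a twin: the non-square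
    involutions are leaves hanging at the identity, hence twins of each other,
    and y, being nontrivial and not adjacent to t, generates an involution
    u <> t, so that u or t * u is a second non-square involution. *)

(** * Twins and the exchange property *)

Section Twins.
Variables (T : finType) (e : rel T).
Hypothesis e_sym : symmetric e.
Hypothesis e_conn : forall x y, connect e x y.
Local Notation d := (gdist e).

Lemma gdist_refl x : d x x = 0.
Proof. by apply/eqP; rewrite -leqn0; apply: (@gdist_min _ e x [::]). Qed.

Lemma gdist_sym x y : d x y = d y x.
Proof.
suff le a b : d b a <= d a b by apply/eqP; rewrite eqn_leq !le.
have [p [ep lp <-]] := gdist_path (e_conn a b).
have ep' : path e (last a p) (rev (belast a p)).
  by rewrite rev_path (eq_path (e' := e)) // => u v; rewrite e_sym.
have := gdist_min ep'; rewrite size_rev size_belast lp.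
suff -> : last b (rev (belast a p)) = a by [].
by case: (p) lp => [<- //|c q] _ /=; rewrite rev_cons last_rcons.
Qed.

Lemma gdist_eq0 x y : (d x y == 0) = (x == y).
Proof.
apply/eqP/eqP => [d0|->]; last exact: gdist_refl.
by have := gdist_path (e_conn x y); rewrite d0 => -[p [_ <-]]; case: p.
Qed.

Lemma gdist_eq1 x y : x != y -> (d x y == 1) = e x y.
Proof.
move=> xy; apply/eqP/idP => [d1|exy].
  have := gdist_path (e_conn x y); rewrite d1 => -[p [ep <-]].
  by case: p ep => [|c [|//]] //= /andP[].
apply/eqP; rewrite eqn_leq lt0n gdist_eq0 xy andbT.
by apply: (@gdist_min _ e x [:: y]); rewrite /= exy.
Qed.

Lemma resolvingP (W : {set T}) :
  reflect (forall x y, x != y -> exists2 z, z \in W & d x z != d y z)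
          (resolving e W).
Proof.
apply: (iffP (injectiveP _)) => [inj x y|sep x y /eq_in_map eqxy].
  move=> xy; apply/exists_inP; rewrite -negb_forall_in.
  apply: contra xy => /forall_inP same; apply/eqP/inj/eq_in_map => z.
  by rewrite mem_enum => /same /eqP.
apply/eqP; case: eqVneq => // /sep[z zW]; rewrite eqxy ?eqxx //.
by rewrite mem_enum.
Qed.

Definition twin (x y : T) : bool :=
  [forall z, (z != x) && (z != y) ==> (d x z == d y z)].

Lemma twinP x y :
  reflect (forall z, z != x -> z != y -> d x z = d y z) (twin x y).
Proof.
apply: (iffP forallP) => [tw z zx zy|tw z].
  by apply/eqP; have /implyP := tw z; apply; rewrite zx.
by apply/implyP => /andP[zx zy]; rewrite tw.
Qed.

Lemma twin_sym x y : twin x y = twin y x.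
Proof. by apply/twinP/twinP => tw z zx zy; rewrite tw. Qed.

Definition has_twin (z : T) : bool := [exists w, (w != z) && twin z w].

Lemma resolving_twin (W : {set T}) x y :
  resolving e W -> x != y -> twin x y -> (x \in W) || (y \in W).
Proof.
move=> /resolvingP res xy /twinP tw; have [z zW] := res _ _ xy.
case: (eqVneq z x) zW => [-> -> //|zx]; case: (eqVneq z y) => [-> -> |zy _].
  by rewrite orbT.
by rewrite tw ?eqxx.
Qed.

Lemma gdist_tperm u w x y :
  twin u w -> d (tperm u w x) (tperm u w y) = d x y.
Proof.
move=> /twinP tw.
have twr z : z != u -> z != w -> d z u = d z w.
  by move=> zu zw; rewrite !(gdist_sym z) tw.
case: (tpermP u w x) => [->|->|/eqP xu /eqP xw];
  case: (tpermP u w y) => [->|->|/eqP yu /eqP yw];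
  rewrite ?gdist_refl ?(gdist_sym w u) ?(tw y) ?(twr x) //.
Qed.

Lemma resolving_tperm u w (W : {set T}) :
  twin u w -> resolving e W -> resolving e (tperm u w @: W).
Proof.
move=> tw /resolvingP res; apply/resolvingP => x y xy.
have [|z zW dz] := res (tperm u w x) (tperm u w y).
  by rewrite (inj_eq perm_inj).
exists (tperm u w z); first exact: imset_f.
by rewrite -(gdist_tperm x _ tw) -(gdist_tperm y _ tw) tpermK.
Qed.

Lemma minimal_resolving_tperm u w (W : {set T}) :
  twin u w -> minimal_resolving e W ->
  minimal_resolving e (tperm u w @: W).
Proof.
move=> tw /minsetP[res minW].
have tt (A : {set T}) : tperm u w @: (tperm u w @: A) = A.
  rewrite -imset_comp -[RHS]imset_id; apply: eq_imset => x /=.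
  exact: tpermK.
apply/minsetP; split=> [|B resB sB]; first exact: resolving_tperm.
rewrite -(tt B) (minW (tperm u w @: B)) //; first exact: resolving_tperm.
by rewrite -(tt W); apply: imsetS.
Qed.

Lemma imset_tperm u w (W : {set T}) :
  u \in W -> w \notin W -> tperm u w @: W = (W :\ u) :|: [set w].
Proof.
move=> uW wW; apply/setP=> x; rewrite -{1}(tpermK u w x) mem_imset ?inE;
  last exact: perm_inj.
case: tpermP => [->|->|/eqP xu /eqP xw].
- by rewrite eqxx (negPf wW); apply/esym/eqP => uw; rewrite -uw uW in wW.
- by rewrite eqxx orbT.
- by rewrite xu (negPf xw) orbF.
Qed.

(** Third vertices without a twin are harmless when they are never the only
    third vertices telling two non-twins apart. *)
Definition separated_by_twins : Prop :=
  forall x y, x != y -> ~~ twin x y ->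
  exists z, [/\ z != x, z != y, d x z != d y z & has_twin z].

(** A set meeting all pairs of twins contains x, or y, or one of the vertices
    z, z' of a pair of twins separating x from y; and z, z' do so equally. *)
Lemma resolving_of_twin_cover (W : {set T}) :
  separated_by_twins ->
  (forall x y, x != y -> twin x y -> (x \in W) || (y \in W)) ->
  resolving e W.
Proof.
move=> sep cov; apply/resolvingP => x y xy.
have [xW|xW] := boolP (x \in W).
  by exists x; rewrite // gdist_refl eq_sym gdist_eq0 eq_sym.
have [yW|yW] := boolP (y \in W).
  by exists y; rewrite // gdist_refl gdist_eq0.
have ntw : ~~ twin x y.
  by apply/negP => /(cov _ _ xy); rewrite (negPf xW) (negPf yW).
have [z [zx zy dz /existsP[w /andP[wz tw]]]] := sep _ _ xy ntw.
have [zW|zW] := boolP (z \in W); first by exists z.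
have wW : w \in W by have := cov z w; rewrite eq_sym wz (negPf zW) => /(_ isT tw).
exists w => //; move/twinP: tw => tw.
have neW v : v \notin W -> v != w by apply: contraNneq => ->.
by rewrite !(gdist_sym _ w) -!tw 1?[_ == z]eq_sym ?neW // !(gdist_sym z).
Qed.

Theorem exchange_of_separation : separated_by_twins -> exchange_property e.
Proof.
move=> sep W1 W2 min1 min2 u uW1.
have [uW2|uW2] := boolP (u \in W2).
  by exists u; rewrite // setUC setD1K.
have [res1 le1] := minsetP min1; have [res2 _] := minsetP min2.
have [w [wu tw wW1]] : exists w, [/\ w != u, twin u w & w \notin W1].
  apply/'exists_and3P; apply: contraT; rewrite negb_exists => /forallP no_w.
  have in_W1 w : w != u -> twin u w -> w \in W1.
    by move=> wu tw; have := no_w w; rewrite wu tw /= negbK.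
  suff res : resolving e (W1 :\ u).
    by have := uW1; rewrite -(le1 _ res (subD1set _ _)) !inE eqxx.
  apply: resolving_of_twin_cover => // x y xy tw; rewrite !inE.
  case: (eqVneq x u) tw xy => [->|xu]; case: (eqVneq y u) => [->|yu] tw.
  - by [].
  - by rewrite (in_W1 y) ?orbT.
  - by rewrite in_W1 // twin_sym.
  - by move=> xy; apply: resolving_twin tw.
have wW2 : w \in W2.
  have := resolving_twin res2 _ tw.
  by rewrite eq_sym wu (negPf uW2) => /(_ isT).
exists w => //; rewrite -imset_tperm //.
exact: minimal_resolving_tperm.
Qed.

End Twins.

(** * Distances and twins in a power graph *)

Section PowerGraphTwins.
Variable gT : finGroupType.
Implicit Types s t u x y z : gT.
Local Open Scope group_scope.
Local Notation e := (power_graph gT).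

Let e_sym := @power_graph_sym gT.
Let e_conn := @power_graph_connected gT.

Lemma is_power_cycle x y : is_power x y = (y \in <[x]>).
Proof.
apply/is_powerP/cycleP => [[m [_ <-]]|[[|m] ->]]; first by exists m.
  by exists #[x]; rewrite expg_order.
by exists m.+1.
Qed.

Lemma power_graphE x y :
  e x y = (x != y) && ((y \in <[x]>) || (x \in <[y]>)).
Proof. by rewrite /power_graph !is_power_cycle. Qed.

Lemma power_graph1 y : y != 1 -> e 1 y.
Proof. by rewrite power_graphE eq_sym => ->; rewrite group1 orbT. Qed.

Lemma power_graph_gdist x y :
  gdist e x y = if x == y then 0%N else if e x y then 1%N else 2%N.
Proof.
case: eqVneq => [->|xy]; first exact: gdist_refl.
case: ifPn => exy; first by apply/eqP; rewrite gdist_eq1.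
apply/eqP; rewrite eqn_leq; apply/andP; split; last first.
  rewrite ltn_neqAle lt0n eq_sym gdist_eq1 // exy.
  by rewrite gdist_eq0.
have x1 : x != 1.
  by apply: contraNneq exy => x1; rewrite x1 power_graph1 // eq_sym -x1.
have y1 : y != 1.
  by apply: contraNneq exy => y1; rewrite e_sym y1 power_graph1 // -y1.
by apply: (@gdist_min _ e x [:: 1; y]); rewrite /= e_sym !power_graph1.
Qed.

Lemma power_graph_separate x y z :
  z != x -> z != y -> (gdist e x z != gdist e y z) = (e x z != e y z).
Proof.
move=> zx zy; rewrite !power_graph_gdist ![_ == z]eq_sym (negPf zx) (negPf zy).
by do 2!case: (e _ z).
Qed.

Lemma power_graph_twinP x y :
  reflect (forall z, z != x -> z != y -> e x z = e y z) (twin e x y).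
Proof.
by apply: (iffP (twinP _ _ _)) => tw z zx zy; apply/eqP; have/eqP := tw z zx zy;
  apply: contraLR; rewrite power_graph_separate.
Qed.

Lemma cycle_eq_twin x y : <[x]> = <[y]> -> twin e x y.
Proof.
move=> xy; apply/power_graph_twinP => z zx zy.
by rewrite !power_graphE ![_ == z]eq_sym zx zy xy -!(cycle_subG _ <[z]>) xy.
Qed.

Lemma has_twin_inv x : x ^+ 2 != 1 -> has_twin e x.
Proof.
move=> x2; apply/existsP; exists x^-1; rewrite cycle_eq_twin ?cycleV // andbT.
by apply: contra x2 => /eqP xV; rewrite expgS expg1 -{1}xV mulVg.
Qed.

(** The identity separates nothing and other elements have their inverses as
    twins, so that separation is only in question at involutions. *)
Lemma separated_by_twins_involution :
  (forall x y t, t != x -> t != y -> #[t] = 2%N -> e x t -> ~~ e y t ->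
   exists z, [/\ z != x, z != y, e x z != e y z & has_twin e z]) ->
  separated_by_twins e.
Proof.
move=> inv x y xy ntw.
have [z zx [zy dz]] : exists2 z, z != x & z != y /\ e x z != e y z.
  have /forallPn[z] := ntw; rewrite negb_imply => /andP[/andP[zx zy]].
  by rewrite power_graph_separate // => dz; exists z.
suff [w [wx wy dw tw]] :
    exists w, [/\ w != x, w != y, e x w != e y w & has_twin e w].
  by exists w; split; rewrite // power_graph_separate.
have [z2|z2] := eqVneq (z ^+ 2) 1; last by exists z; rewrite has_twin_inv.
have [z1|z1] := eqVneq z 1.
  move: zx zy dz; rewrite z1 ![1 == _]eq_sym => x1 y1.
  by rewrite !(e_sym _ 1) !power_graph1.
have oz : #[z] = 2%N by apply: nt_prime_order.
case exz: (e x z) dz; case eyz: (e y z) => // _.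
  by apply: (inv _ _ z); rewrite ?exz ?eyz.
have [w [wy wx dw tw]] : exists w, [/\ w != y, w != x, e y w != e x w
    & has_twin e w] by apply: (inv _ _ z); rewrite ?exz ?eyz.
by exists w; split; rewrite // eq_sym.
Qed.

Lemma odd_separated : odd #|[set: gT]| -> separated_by_twins e.
Proof.
move=> oddG; apply: separated_by_twins_involution => x y t _ _ ot.
have : odd #[t] by apply: dvdn_odd oddG; apply: order_dvdG; rewrite inE.
by rewrite ot.
Qed.

(** * Involutions of an abelian 2-group *)

Lemma mem_cycle_involution t x :
  #[t] = 2%N -> (x \in <[t]>) = (x == 1) || (x == t).
Proof.
by move=> ot; rewrite cycle2g // !inE.
Qed.

Section TwoGroup.
Hypothesis twoG : 2.-group [set: gT].

Let order2 x : 2.-nat #[x].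
Proof. by apply: (mem_p_elt twoG); rewrite inE. Qed.

(** A nontrivial element generates some involution, and a cyclic group has at
    most one. *)
Lemma cycle_has_involution y :
  y != 1 -> exists2 u, u \in <[y]> & #[u] = 2%N.
Proof.
move=> y1; have ny1 : <[y]> != 1 by rewrite cycle_eq1.
have [pr2 dv _] := pgroup_pdiv (order2 y : 2.-group <[y]>) ny1.
by have [u uy ou] := Cauchy pr2 dv; exists u.
Qed.

Lemma involution_mem_cycle x y t :
  #[t] = 2%N -> t \in <[x]> -> y \in <[x]> -> y != 1 -> t \in <[y]>.
Proof.
move=> ot tx yx /cycle_has_involution[u uy ou].
have ux : u \in <[x]> by apply: subsetP uy; rewrite cycle_subG.
have tu : <[t]> = <[u]>.
  apply/eqP; rewrite (eq_subG_cyclic (cycle_cyclic x)) ?cycle_subG //.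
  by rewrite -!orderE ot ou.
by rewrite -cycle_subG tu cycle_subG.
Qed.

(** An involution in the cyclic group of z is an even power of z, hence a
    square, unless it is z itself. *)
Lemma nonsquare_mem_cycle t z :
  #[t] = 2%N -> (forall s, s ^+ 2 != t) -> t \in <[z]> -> z = t.
Proof.
move=> ot nsq /cycleP[k tk]; have [odd_k|even_k] := boolP (odd k).
  have zt : <[z]> = <[t]>.
    apply/eqP; rewrite -[_ == _]/(generator <[z]> t) tk generator_coprime.
    by rewrite (pnat_coprime (order2 z)) // p'natE // dvdn2 odd_k.
  have := cycle_id z; rewrite zt mem_cycle_involution // => /orP[]/eqP // z1.
  by have := ot; rewrite orderE -zt z1 -orderE order1.
have := nsq (z ^+ k./2).
by rewrite -expgM muln2 even_halfK // tk eqxx.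
Qed.

(** Both are adjacent to the identity only. *)
Lemma nonsquare_involution_twin t u :
  #[t] = 2%N -> #[u] = 2%N ->
  (forall s, s ^+ 2 != t) -> (forall s, s ^+ 2 != u) -> twin e t u.
Proof.
move=> ot ou nst nsu; apply/power_graph_twinP => z zt zu.
have leaf v : #[v] = 2%N -> (forall s, s ^+ 2 != v) -> z != v ->
    e v z = (z == 1).
  move=> ov nsv zv; rewrite power_graphE eq_sym zv mem_cycle_involution //.
  rewrite (negPf zv) orbF; apply/orP/idP => [[//|/nonsquare_mem_cycle]|->].
    by move=> /(_ ov nsv) vz; rewrite vz eqxx in zv.
  by left.
by rewrite !leaf.
Qed.

Hypothesis abelG : abelian [set: gT].

Let commG x y : commute x y.
Proof. by apply: (centsP abelG); rewrite inE. Qed.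

Lemma order2_nt t : #[t] = 2%N -> t != 1.
Proof. by move=> ot; rewrite -order_gt1 ot. Qed.

Lemma order2_sqr t : #[t] = 2%N -> t ^+ 2 = 1.
Proof. by move=> <-; apply: expg_order. Qed.

(** If another involution u is itself no square, it is a twin of t;
    otherwise t * u is no square and is one. *)
Lemma has_twin_nonsquare_involution t u :
  #[t] = 2%N -> #[u] = 2%N -> u != t -> (forall s, s ^+ 2 != t) ->
  has_twin e t.
Proof.
move=> ot ou ut nst.
have [/existsP[s /eqP su]|] := boolP [exists s, s ^+ 2 == u]; last first.
  rewrite negb_exists => /forallP nsu; apply/existsP; exists u.
  by rewrite ut nonsquare_involution_twin.
have tu : t * u != t by rewrite -[X in _ != X]mulg1 (inj_eq (mulgI t)) order2_nt.
apply/existsP; exists (t * u); rewrite tu.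
apply: nonsquare_involution_twin => // [|r].
  apply: nt_prime_order => //.
    by rewrite (expgMn _ (commG _ _)) !order2_sqr // mulg1.
  apply: contraNneq ut => tu1.
  by rewrite -(mulKg t u) tu1 mulg1 eq_invg_mul -expg2 order2_sqr.
apply: contra (nst (r * s^-1)) => /eqP r2.
by rewrite (expgMn _ (commG _ _)) r2 expVgn su mulgK.
Qed.

Lemma abelian_2group_separated : separated_by_twins e.
Proof.
apply: separated_by_twins_involution => x y t tx ty ot ext neyt.
have y1 : y != 1.
  by apply: contraNneq neyt => ->; rewrite power_graph1 ?order2_nt.
have tNy : t \notin <[y]>.
  by apply: contra neyt => tin; rewrite power_graphE eq_sym ty tin.
(* No cyclic subgroup containing t meets that of y nontrivially. *)
have far z : t \in <[z]> -> e y z = false.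
  move=> tz; apply: contraNF tNy; rewrite power_graphE => /andP[_ /orP[zy|yz]].
    by apply: subsetP tz; rewrite cycle_subG.
  exact: involution_mem_cycle yz y1.
have neq_y z : t \in <[z]> -> z != y by apply: contraTneq => ->.
have [x1|x1] := eqVneq x 1.
  have [/existsP[s /eqP st]|] := boolP [exists s, s ^+ 2 == t]; last first.
    rewrite negb_exists => /forallP nst.
    have [u uy ou] := cycle_has_involution y1.
    exists t; rewrite tx ty ext (negPf neyt); split=> //.
    apply: has_twin_nonsquare_involution ou _ nst => //.
    by apply: contraNneq tNy => <-.
  have ts : t \in <[s]> by rewrite -st mem_cycle.
  have s1 : s != 1.
    by apply: contraNneq (order2_nt ot) => s1; rewrite -st s1 expg1n.
  exists s; rewrite x1 s1 neq_y // far // power_graph1 //.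
  by split; rewrite ?has_twin_inv // st order2_nt.
have txin : t \in <[x]>.
  move: ext; rewrite power_graphE eq_sym tx (mem_cycle_involution x ot).
  by rewrite (negPf x1) [x == t]eq_sym (negPf tx) !orbF.
have x2 : x ^+ 2 != 1.
  apply: contra tx => /eqP x2; have ox : #[x] = 2%N by apply: nt_prime_order.
  by move: txin; rewrite mem_cycle_involution // (negPf (order2_nt ot)).
have xV : x^-1 != x.
  by apply: contra x2 => /eqP xV; rewrite expgS expg1 -{1}xV mulVg.
have txV : t \in <[x^-1]> by rewrite cycleV.
exists x^-1; split; rewrite ?neq_y ?has_twin_inv ?expVgn ?invg_eq1 //.
by rewrite far // power_graphE [x == _]eq_sym xV cycleV cycle_id orbT.
Qed.

End TwoGroup.
End PowerGraphTwins.

Theorem theorem1p5 (gT : finGroupType) :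
  (cyclic [set: gT] /\ exists k : nat, 0 < k /\ #|[set: gT]| = 2 * k + 1) \/
  (exists p n : nat, prime p /\ #|[set: gT]| = p ^ n) /\ abelian [set: gT] ->
  exchange_property (power_graph gT).
Proof.
move=> cases; apply: exchange_of_separation.
- exact: power_graph_sym.
- exact: power_graph_connected.
case: cases => [[_ [k [_ oG]]]|[[p [n [p_pr oG]]] abelG]].
  by apply: odd_separated; rewrite oG addn1 mul2n /= odd_double.
case: (even_prime p_pr) => [p2|odd_p].
  by apply: abelian_2group_separated => //; rewrite /pgroup oG p2 pnatX.
by apply: odd_separated; rewrite oG oddX odd_p orbT.
Qed.
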